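(* Let $\mathcal{V}_0$ be the function $$\mathcal{V}_0(q,p)=U(q)+\frac{\gamma^2}{4}\left(|q+\gamma^{-1}p|^2+|\gamma^{-1}p|^2-\lambda|q|^2\right).$$ Then for every $\alpha\ge 0$ the generator $\mathcal{L}_\alpha$ of the HFHR dynamics satisfies $$\mathcal{L}_\alpha\mathcal{V}_0(q,p)\le\gamma\left(d+A_\alpha-\hat\lambda_\alpha\,\mathcal{V}_0(q,p)\right),\qquad (q,p)\in\mathbb{R}^{2d},$$ where $A_\alpha:=A+\frac{J_1}{\gamma}\alpha$, $\hat\lambda_\alpha:=\lambda-\frac{J_1}{\gamma}\alpha$, and $J_1$ can be chosen explicitly as $J_1:=K_A+K_\Delta$ with $$K_A:=\frac{1}{c_1}\left[\frac{\gamma^4}{4}(1-\lambda)^2+\frac{\gamma^2}{4}\right],\qquad K_\Delta:=Ld+\frac{\gamma^2}{2}d(1-\lambda),\qquad c_1:=\min(1,\mu_{\min}).$$ In particular $\hat\lambda_\alpha=\lambda-\frac{\alpha}{\gamma}\left\{\frac{1}{c_1}\left[\frac{\gamma^4}{4}(1-\lambda)^2+\frac{\gamma^2}{4}\right]+Ld+\frac{\gamma^2}{2}d(1-\lambda)\right\}$. Consequently, with $$\alpha_0:=\frac{\gamma\lambda}{2}\left\{\frac{1}{c_1}\left[\frac{\gamma^4}{4}(1-\lambda)^2+\frac{\gamma^2}{4}\right]+Ld+\frac{\gamma^2}{2}d(1-\lambda)\right\}^{-1},$$ one has $\hat\lambda_\alpha\ge\lambda/2>0$ for all $\alpha\in[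0,\alpha_0]$.
   Context: Fix an integer $d\ge1$ and $\gamma>0$; $|\cdot|$ is the Euclidean norm. Points of $\mathbb{R}^{2d}$ are written $(q,p)$, $q,p\in\mathbb{R}^d$. Assumption on $U:\mathbb{R}^d\to\mathbb{R}$: there are constants $L,A\in(0,\infty)$ and $\lambda\in(0,1/4]$ such that (i) $U\in C^1(\mathbb{R}^d)$ and $U\ge0$; (ii) $|\nabla U(q)-\nabla U(q')|\le L|q-q'|$ for all $q,q'$; (iii) $\frac12 q\cdot\nabla U(q)\ge\lambda\left(U(q)+\frac{\gamma^2}{4}|q|^2\right)-A$ for all $q$. The HFHR dynamics with parameter $\alpha\ge0$ is $dq_t=(p_t-\alpha\nabla U(q_t))dt+\sqrt{2\alpha}\,dB^q_t$, $dp_t=(-\gamma p_t-\nabla U(q_t))dt+\sqrt{2\gamma}\,dB^p_t$ with independent standard $d$-dimensional Brownian motions $B^q,B^p$. Its generator is $$\mathcal{L}_\alpha\varphi=(p-\alpha\nabla U(q))\cdot\nabla_q\varphi+(-\gamma p-\nabla U(q))\cdot\nabla_p\varphi+\alpha\Delta_q\varphi+\gamma\Delta_p\varphi.$$ Since $\nabla U$ is only Lipschitz, second derivatives of $U$ exist almost everywhere and inequalities involving them are understood almost everywhere. $\mu_{\min}:=\frac18\left(\gamma^2(1-\lambda)+2-\sqrt{(\gamma^2(1-\lambda)-2)^2+4\gamma^2}\right)>0$ (the smallest eigenvalue of $\frac14\begin{pmatrix}\gamma^2(1-\lambda)&\gamma\\ \gamma&2\end{pmatrix}$). *)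

(* Defs.v *)
From HB Require Import structures.
From mathcomp Require Import all_boot all_order all_algebra.
From mathcomp Require Import all_classical all_reals all_analysis.

Set Implicit Arguments.
Unset Strict Implicit.
Unset Printing Implicit Defensive.

Import Order.TTheory GRing.Theory Num.Theory.
Import numFieldNormedType.Exports.

Local Open Scope classical_set_scope.
Local Open Scope ring_scope.

(* The library norm on ['rV[R]_n] is the sup norm, hence the explicit Euclidean
   norm; both induce the same topology, so the library notions of continuity
   and differentiability on ['rV[R]_n] are the usual ones. *)
Definition dotp (R : realType) (n : nat) (x y : 'rV[R]_n) : R :=
  \sum_(i < n) x 0 i * y 0 i.

Definition enorm (R : realType) (n : nat) (x : 'rV[R]_n) : R :=
  Num.sqrt (\sum_(i < n) x 0 i ^+ 2).

Definition partial (R : realType) (n : nat) (i : 'I_n) (f : 'rV[R]_n -> R)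
  (x : 'rV[R]_n) : R := 'D_(delta_mx 0 i) f x.

Definition grad (R : realType) (n : nat) (f : 'rV[R]_n -> R) (x : 'rV[R]_n) :
  'rV[R]_n := \row_i partial i f x.

Definition laplacian (R : realType) (n : nat) (f : 'rV[R]_n -> R)
  (x : 'rV[R]_n) : R := \sum_(i < n) partial i (partial i f) x.

Definition C1 (R : realType) (n : nat) (f : 'rV[R]_n -> R) : Prop :=
  (forall x, differentiable f x) /\ continuous (grad f).

Definition generator (R : realType) (d : nat) (gamma : R) (U : 'rV[R]_d -> R)
    (alpha : R) (phi : 'rV[R]_d -> 'rV[R]_d -> R) (q p : 'rV[R]_d) : R :=
  dotp (p - alpha *: grad U q) (grad (phi^~ p) q)
  + dotp (- gamma *: p - grad U q) (grad (phi q) p)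
  + alpha * laplacian (phi^~ p) q + gamma * laplacian (phi q) p.

(* [partial] is total, with a dummy value where the derivative does not exist:
   this predicate says that every derivative occurring in [generator] is a
   genuine one. *)
Definition generator_defined (R : realType) (d : nat)
    (phi : 'rV[R]_d -> 'rV[R]_d -> R) (q p : 'rV[R]_d) : Prop :=
  forall i : 'I_d,
    [/\ derivable (phi^~ p) q (delta_mx 0 i),
        derivable (phi q) p (delta_mx 0 i),
        derivable (partial i (phi^~ p)) q (delta_mx 0 i) &
        derivable (partial i (phi q)) p (delta_mx 0 i)].

Definition V0 (R : realType) (d : nat) (gamma lambda : R) (U : 'rV[R]_d -> R)
    (q p : 'rV[R]_d) : R :=
  U q + gamma ^+ 2 / 4 *
    (enorm (q + gamma^-1 *: p) ^+ 2 + enorm (gamma^-1 *: p) ^+ 2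
     - lambda * enorm q ^+ 2).

Definition mu_min (R : realType) (gamma lambda : R) : R :=
  8^-1 * (gamma ^+ 2 * (1 - lambda) + 2
          - Num.sqrt ((gamma ^+ 2 * (1 - lambda) - 2) ^+ 2 + 4 * gamma ^+ 2)).

Definition c1 (R : realType) (gamma lambda : R) : R :=
  Num.min 1 (mu_min gamma lambda).

Definition K_A (R : realType) (gamma lambda : R) : R :=
  (c1 gamma lambda)^-1 *
    (gamma ^+ 4 / 4 * (1 - lambda) ^+ 2 + gamma ^+ 2 / 4).

Definition K_Delta (R : realType) (d : nat) (gamma L lambda : R) : R :=
  L * d%:R + gamma ^+ 2 / 2 * d%:R * (1 - lambda).

Definition J1 (R : realType) (d : nat) (gamma L lambda : R) : R :=
  K_A gamma lambda + K_Delta d gamma L lambda.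

Definition A_alpha (R : realType) (d : nat) (gamma L A lambda alpha : R) : R :=
  A + J1 d gamma L lambda / gamma * alpha.

Definition lambda_hat (R : realType) (d : nat) (gamma L lambda alpha : R) : R :=
  lambda - J1 d gamma L lambda / gamma * alpha.

Definition alpha0 (R : realType) (d : nat) (gamma L lambda : R) : R :=
  gamma * lambda / 2 *
    ((c1 gamma lambda)^-1 *
       (gamma ^+ 4 / 4 * (1 - lambda) ^+ 2 + gamma ^+ 2 / 4)
     + L * d%:R + gamma ^+ 2 / 2 * d%:R * (1 - lambda))^-1.

(* n-dimensional Lebesgue measure, as the n-fold product of the one-dimensional
   one.  It is carried by tuples because row vectors have no measurable
   structure in the library. *)
Definition cons_pair (R : realType) (n : nat)
    (xt : measurableTypeR R * n.-tuple (measurableTypeR R)) :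
    n.+1.-tuple (measurableTypeR R) := [tuple of xt.1 :: xt.2].

Lemma measurable_cons_pair (R : realType) (n : nat) :
  measurable_fun [set: measurableTypeR R * n.-tuple (measurableTypeR R)]
    (@cons_pair R n).
Proof. exact: measurable_cons. Qed.

Definition lebesgue_cons (R : realType) (n : nat)
    (m : {sigma_finite_measure set (n.-tuple (measurableTypeR R)) -> \bar R}) :
    set (n.+1.-tuple (measurableTypeR R)) -> \bar R :=
  pushforward (@lebesgue_measure R \x m)%E (@cons_pair R n).

Section lebesgue_cons_measure.
Context (R : realType) (n : nat).
Context (m : {sigma_finite_measure set (n.-tuple (measurableTypeR R)) -> \bar R}).

Let lebesgue_cons0 : lebesgue_cons m set0 = 0%E.
Proof. by rewrite /lebesgue_cons /pushforward preimage_set0 measure0. Qed.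

Let lebesgue_cons_ge0 A : (0 <= lebesgue_cons m A)%E.
Proof. by rewrite /lebesgue_cons /pushforward; exact: measure_ge0. Qed.

Let lebesgue_cons_sigma_additive : semi_sigma_additive (lebesgue_cons m).
Proof.
move=> F mF tF mUF; rewrite /lebesgue_cons /pushforward preimage_bigcup.
have mp B : measurable B -> measurable (@cons_pair R n @^-1` B).
  by move=> mB; rewrite -[X in measurable X]setTI; exact: measurable_cons_pair.
apply: measure_semi_sigma_additive.
- by move=> k; exact: mp.
- apply/trivIsetP => i j _ _ ij; rewrite -preimage_setI.
  by have /trivIsetP -> := tF => //; rewrite preimage_set0.
- by rewrite -preimage_bigcup; exact: mp.
Qed.

HB.instance Definition _ := isMeasure.Build _ _ _ (lebesgue_cons m)
  lebesgue_cons0 lebesgue_cons_ge0 lebesgue_cons_sigma_additive.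

Let lebesgue_cons_sigma_finite : sigma_finite setT (lebesgue_cons m).
Proof.
have /sigma_finiteP[F [FT ndF Foo]] := sigma_finiteT (@lebesgue_measure R).
have /sigma_finiteP[G [GT ndG Goo]] := sigma_finiteT m.
pose split_tuple (t : n.+1.-tuple (measurableTypeR R)) :
    measurableTypeR R * n.-tuple (measurableTypeR R) :=
  (tnth t ord0, [tuple of behead t]).
have splitK : cancel (@cons_pair R n) split_tuple.
  by move=> [x t]; congr pair; apply/val_inj.
have consK : cancel split_tuple (@cons_pair R n).
  by move=> t; rewrite /cons_pair/= -tuple_eta.
have msplit : measurable_fun setT split_tuple.
  by apply: measurable_fun_pair; [exact: measurable_tnth|exact: measurable_behead].
exists (fun k => split_tuple @^-1` (F k `*` G k)).
  rewrite -preimage_bigcup (_ : \bigcup_k _ = setT) ?preimage_setT//.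
  rewrite -setXTT FT GT predeqE => -[x t]; split.
    by move=> [k _ []/= ? ?]; split; exists k.
  move=> [/= [j _ Fx] [k _ Gt]]; exists (maxn j k) => //; split.
  - by move: x Fx; exact/subsetPset/ndF/leq_maxl.
  - by move: t Gt; exact/subsetPset/ndG/leq_maxr.
move=> k; have [mF Fkoo] := Foo k; have [mG Gkoo] := Goo k; split.
  by rewrite -[X in measurable X]setTI; apply: msplit => //; exact: measurableX.
rewrite /lebesgue_cons /pushforward -comp_preimage.
rewrite (_ : _ \o _ = id) ?preimage_id; last first.
  by apply/funext => x; exact: splitK.
by rewrite product_measure1E// lte_mul_pinfty// ge0_fin_numE.
Qed.

HB.instance Definition _ := Measure_isSigmaFinite.Build _ _ _ (lebesgue_cons m)
  lebesgue_cons_sigma_finite.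

End lebesgue_cons_measure.

Fixpoint lebesgue_tuple (R : realType) (n : nat) :
    {sigma_finite_measure set (n.-tuple (measurableTypeR R)) -> \bar R} :=
  match n with
  | 0 => \d_ [tuple]
  | n'.+1 => lebesgue_cons (lebesgue_tuple R n')
  end.

Lemma lebesgue_tuple_box (R : realType) (n : nat)
    (B : 'I_n -> set (measurableTypeR R)) :
  (forall i, measurable (B i)) ->
  lebesgue_tuple R n [set t | forall i, B i (tnth t i)] =
  (\prod_(i < n) lebesgue_measure (B i))%E.
Proof.
elim: n B => [|n IHn] B mB.
  rewrite big_ord0 /= diracE mem_set//=; by case.
have mbox k (C : 'I_k -> set (measurableTypeR R)) : (forall i, measurable (C i)) ->
    measurable [set t : k.-tuple (measurableTypeR R) | forall i, C i (tnth t i)].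
  move=> mC.
  rewrite (_ : [set _ | _] = \bigcap_(i in [set: 'I_k]) ((@tnth _ _)^~ i @^-1` C i)).
    apply: fin_bigcap_measurable => // i _.
    by rewrite -[X in measurable X]setTI; exact: measurable_tnth.
  by apply/seteqP; split => t /= H i *; exact: H.
rewrite big_ord_recl /= -(IHn (B \o lift ord0)); last by move=> i; exact: mB.
rewrite /lebesgue_cons /pushforward -product_measure1E//; last first.
  by apply: mbox => i; exact: mB.
congr (product_measure1 _ _ _); apply/seteqP; split => -[x t] /=.
  move=> H; split; first exact: (H ord0).
  by move=> i; have := H (lift ord0 i); rewrite /cons_pair tnthS.
move=> [Bx Bt] i; case: (unliftP ord0 i) => [j ->|-> //].
by rewrite /cons_pair tnthS; exact: Bt.
Qed.

Definition row_of_tuple (R : realType) (n : nat)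
    (t : n.-tuple (measurableTypeR R)) : 'rV[R]_n := \row_i tnth t i.

Definition ae_phase_space (R : realType) (d : nat)
    (P : 'rV[R]_d -> 'rV[R]_d -> Prop) : Prop :=
  {ae (lebesgue_tuple R d \x lebesgue_tuple R d)%E,
    forall z, P (row_of_tuple z.1) (row_of_tuple z.2)}.

(* Main.v *)
Require Import Defs.
From HB Require Import structures.
From mathcomp Require Import all_boot all_order all_algebra.
From mathcomp Require Import all_classical all_reals all_analysis.
From mathcomp Require Import measurable_realfun ring lra.

Import Order.TTheory GRing.Theory Num.Theory.
Import numFieldNormedType.Exports.

Local Open Scope classical_set_scope.
Local Open Scope ring_scope.

(* Write V for V0, g for the gradient of U at q, and w for
   (gamma^2/2)(1 - lambda) q + (gamma/2) p, so that grad_q V = g + w and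
   grad_p V = (gamma/2) q + p.  The part of the generator that does not involve
   alpha is bounded by the drift condition.  The part carrying alpha is
   - g.(g + w) + Delta_q V: completing the square gives - g.(g + w) <= |w|^2 / 4,
   which is at most a multiple of |q|^2 + |p|^2, hence of V, because V - U is a
   quadratic form with smallest eigenvalue mu_min; and Delta U <= L d since the
   gradient is L-Lipschitz.

   The second derivatives exist almost everywhere because each partial
   derivative of U is Lipschitz along its own axis.  In one dimension, a
   nondecreasing 1-Lipschitz f has a Stieltjes measure dominated by Lebesgue
   measure (the measures of f and of x - f add up to it), so it is the integral
   of its Radon-Nikodym density and Lebesgue differentiation applies.  The set of
   non-derivability of a continuous function is Borel, being described by a
   Cauchy criterion over rational increments, so Tonelli passes from lines to
   the whole space. *)

(** * Differentiability of Lipschitz functions on the line *)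

Lemma lebesgue_stieltjes_measure_oc (R : realType) (f : cumulative R R)
    (a b : R) : a <= b ->
  lebesgue_stieltjes_measure f `]a, b]%classic = (f b - f a)%:E.
Proof.
move=> ab; rewrite /lebesgue_stieltjes_measure /measure_extension.
rewrite measurable_mu_extE/=; last exact: is_ocitv.
by rewrite wlength_itv_bnd.
Qed.

(** The sum of the two Stieltjes measures gives each interval []a, b]] its length, so it is Lebesgue
    measure by uniqueness; the share of [g] is nonnegative. *)
Lemma stieltjes_le_lebesgue (R : realType) (f g : cumulative R R) :
  (forall x, f x + g x = x) ->
  forall A, measurable A ->
    (lebesgue_stieltjes_measure f A <= lebesgue_measure A)%E.
Proof.
move=> fg A mA.
have -> : lebesgue_measure A = measure_add (lebesgue_stieltjes_measure f)
    (lebesgue_stieltjes_measure g) A; last first.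
  by rewrite [leRHS]measure_addE leeDl.
apply: lebesgue_measure_unique => // _ [[a b] _ <-] /=.
rewrite [RHS]measure_addE.
have [ab|ba] := leP a b; last first.
  by rewrite set_itv_ge ?measure0 ?adde0// bnd_simp -leNgt ltW.
rewrite [LHS]lebesgue_stieltjes_measure_oc//.
rewrite [X in _ = (X + _)%E]lebesgue_stieltjes_measure_oc//.
rewrite [X in _ = (_ + X)%E]lebesgue_stieltjes_measure_oc//.
rewrite -EFinD; congr EFin.
by rewrite /= -[b in LHS]fg -[a in LHS]fg; ring.
Qed.

Lemma lip1_nondecreasing_ae_derivable (R : realType) (f : R -> R) :
  {homo f : x y / x <= y} -> (forall x y, x <= y -> f y - f x <= y - x) ->
  {ae (@lebesgue_measure R), forall x, derivable f x 1}.
Proof.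
move=> ndf lipf.
have cf : continuous f.
  move=> x; apply/cvgrPdist_le => /= e e0; near=> y.
  have : `|x - y| <= e by near: y; apply: cvgr_dist_le.
  have [xy|yx] := leP x y.
    by apply: le_trans; rewrite distrC (distrC x) !ger0_norm ?subr_ge0 ?ndf ?lipf.
  move/ltW : yx => yx.
  by apply: le_trans; rewrite !ger0_norm ?subr_ge0 ?ndf ?lipf.
have ndg : {homo (fun x => x - f x) : x y / x <= y}.
  by move=> x y /lipf xy; lra.
have rcg : right_continuous (fun x => x - f x).
  by apply: right_continuousW => x; apply: cvgB; [exact: cvg_id|exact: cf].
pose F : cumulative R R := HB.pack f
  (isCumulative.Build R _ R f ndf (right_continuousW cf)).
pose G : cumulative R R := HB.pack (fun x => x - f x)
  (isCumulative.Build R _ R (fun x => x - f x) ndg rcg).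
have nuF := stieltjes_le_lebesgue _ F G (fun x => subrKC (f x) x).
(* The Stieltjes measure of [F] may have infinite mass. Its restriction to a bounded window is
   finite, so Radon-Nikodym applies; the windows exhaust the line. *)
have mdom n : measurable (`](- n%:R : R), n%:R]%classic : set (measurableTypeR R)).
  exact: measurable_itv.
have foo n : (lebesgue_stieltjes_measure F `](- n%:R)%R, n%:R]%classic < +oo)%E.
  by rewrite lebesgue_stieltjes_measure_oc ?ltry// ge0_cp.
have aen n : {ae (@lebesgue_measure R), forall x, - n%:R < x < n%:R -> derivable f x 1}.
  pose nu := mfrestr (mdom n) (foo n).
  have dom : nu `<< @lebesgue_measure R.
    move=> N N0 B mB BN; apply/eqP; rewrite -measure_le0.
    rewrite (le_trans (le_measure _ _ _ (@subIsetl _ B _))) ?inE//.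
      exact: measurableI.
    by rewrite (le_trans (nuF _ mB))// N0.
  have [k [k0 kfin ik kE]] :=
    @radon_nikodym_sigma_finite _ _ _ (@lebesgue_measure R) nu dom.
  have iK : (@lebesgue_measure R).-integrable setT (EFin \o (fine \o k)).
    by apply: eq_integrable ik => // x _ /=; rewrite fineK.
  have iKS y : (@lebesgue_measure R).-integrable `]-oo, y] (EFin \o (fine \o k)).
    exact: integrableS iK.
  have lK := open_integrable_locally openT iK.
  have := FTC1Ny iKS lK.
  apply: (filterS (Filter := ae_filter_ringOfSetsType _)) => x [dx _] /andP[nx xn].
  (* Since [nu] only charges the window, the integral of its density up to y is [f y - f (- n%:R)]
     for y in the window: near x, f is [I] plus a constant. *)
  pose I y := (\int[lebesgue_measure]_(t in [set` `]-oo, y]]) (fine \o k) t)%R.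
  apply: (@near_eq_derivable _ _ _ (fun y => I y + f (- n%:R))); last first.
    by apply: derivableD => //; exact: derivable_cst.
  near=> y.
  have ny : - n%:R <= y by apply: ltW; near: y; apply: lt_nbhsr.
  have yn : y <= n%:R by apply: ltW; near: y; apply: lt_nbhsl.
  rewrite /I /Rintegral -[X in fine X](_ : nu `]-oo, y]%classic = _); last first.
    apply: (eq_trans (kE _ (measurable_itv _))).
    by apply: eq_integral => z _ /=; rewrite fineK.
  rewrite /nu /mfrestr /mrestr.
  have -> : `]-oo, y] `&` `](- n%:R), n%:R] = `](- n%:R), y]%classic.
    apply/seteqP; split => z /=; rewrite !in_itv/=.
      by move=> [-> /andP[->]].
    by move=> /andP[nz zy]; rewrite zy nz (le_trans zy yn).
  by rewrite lebesgue_stieltjes_measure_oc//= subrK.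
have := ae_foralln aen.
apply: (filterS (Filter := ae_filter_ringOfSetsType _)).
move=> x /(_ (Num.bound `|x|)); apply.
by rewrite -ltr_norml archi_boundP.
Unshelve. all: by end_near. Qed.

(** Adding the linear function [C * x] makes f nondecreasing with slopes in [[0, 2 * C]]; dividing
    by [2 * C] reduces to the monotone 1-Lipschitz case. *)
Lemma lipschitz_ae_derivable (R : realType) (K : R) (f : R -> R) :
  (forall x y, `|f x - f y| <= K * `|x - y|) ->
  {ae (@lebesgue_measure R), forall x, derivable f x 1}.
Proof.
move=> lipf; pose C := `|K| + 1.
have C0 : 0 < C by rewrite ltr_wpDl.
have lipC x y : x <= y -> `|f y - f x| <= C * (y - x).
  move=> xy; rewrite (le_trans (lipf _ _))// ger0_norm ?subr_ge0//.
  by rewrite ler_wpM2r ?subr_ge0// (le_trans (ler_norm _))// lerDl.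
pose h x := (f x + C * x) / (2 * C).
have fE : f = fun x => 2 * C * h x - C * x.
  by apply/funext => x; rewrite /h; field; rewrite gt_eqF.
have : {ae (@lebesgue_measure R), forall x, derivable h x 1}.
  apply: lip1_nondecreasing_ae_derivable => x y /lipC; rewrite ler_norml => /andP[? ?].
    by rewrite ler_pM2r ?invr_gt0 ?mulr_gt0//; lra.
  by rewrite -mulrBl ler_pdivrMr ?mulr_gt0//; lra.
apply: (filterS (Filter := ae_filter_ringOfSetsType _)) => x dh; rewrite fE.
by apply: derivableB; apply: derivableM => //; exact: derivable_cst.
Qed.

(** * Directional differentiability almost everywhere *)

Lemma measurable_exists_countable {disp} {T : measurableType disp}
    (I : countType) (P : I -> T -> Prop) :
  (forall i, measurable [set t | P i t]) -> measurable [set t | exists i, P i t].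
Proof.
move=> mP; rewrite (_ : [set t | _] = \bigcup_i [set t | P i t]).
  by apply: countable_bigcupT_measurable => //; exact: countableP.
by apply/seteqP; split => t /= -[i Pi]; [exists i|exists i].
Qed.

Lemma measurable_forall_countable {disp} {T : measurableType disp}
    (I : countType) (P : I -> T -> Prop) :
  (forall i, measurable [set t | P i t]) -> measurable [set t | forall i, P i t].
Proof.
move=> mP; rewrite (_ : [set t | _] = ~` [set t | exists i, ~ P i t]).
  by apply/measurableC/measurable_exists_countable => i; exact: (measurableC (mP i)).
apply/seteqP; split => t /=; first by move=> H [i]; apply.
by move=> H i; apply: contrapT => Pi; apply: H; exists i.
Qed.

Lemma measurable_imply {disp} {T : measurableType disp} (C : Prop) (P : T -> Prop) :
  measurable [set t | P t] -> measurable [set t | C -> P t].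
Proof.
move=> mP; have [c|nc] := pselect C.
  by rewrite (_ : [set t | _] = [set t | P t])//; apply/seteqP; split => t /=; auto.
by rewrite (_ : [set t | _] = setT)//; apply/seteqP; split => t /=; auto.
Qed.

(** An open set is the union of the countably many boxes with rational centre and radius
    [k.+1%:R^-1] that it contains, and each box is a finite intersection of coordinate
    conditions. *)
Lemma measurable_open_row_of_tuple (R : realType) (n : nat) (O : set 'rV[R]_n) :
  open O -> measurable (@row_of_tuple R n @^-1` O).
Proof.
move=> oO.
pose box (c : n.-tuple rat * nat) (t : n.-tuple (measurableTypeR R)) :=
  forall i, `|tnth t i - ratr (tnth c.1 i)| < c.2.+1%:R^-1.
rewrite (_ : _ @^-1` _ =
    [set t | exists c, (box c `<=` @row_of_tuple R n @^-1` O) /\ box c t]).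
  apply: measurable_exists_countable => c.
  have [sub|nsub] := pselect (box c `<=` @row_of_tuple R n @^-1` O); last first.
    rewrite (_ : [set t | _] = set0)//.
    by apply/seteqP; split => t // -[].
  rewrite (_ : [set t | _] = [set t | box c t]); last first.
    by apply/seteqP; split => t => [[]|].
  apply: measurable_forall_countable => i.
  rewrite (_ : [set t | _] =
      (fun t => tnth t i) @^-1` ball (ratr (tnth c.1 i) : R) c.2.+1%:R^-1).
    rewrite -[X in measurable X]setTI; apply: measurable_tnth => //.
    exact: measurable_ball.
  by apply/seteqP; split => t /=; rewrite /ball/= distrC.
apply/seteqP; split => [t Ot|t [c [sub bt]]]; last exact: sub.
have /nbhs_ballP[e e0 eO] := open_nbhs_nbhs (conj oO Ot).
(* Half the radius: the rational centre lies within [e / 2] of [t], and so does each coordinate of a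
   point of the box from the centre. *)
have [k ke] : exists k : nat, k.+1%:R^-1 < e / 2.
  have e2 : 0 < e / 2 by exact: divr_gt0.
  have [k _ /(_ k (leqnn k))] := near_infty_natSinv_lt (PosNum e2).
  by exists k.
have /choice[c cE] (i : 'I_n) : exists r : rat, `|tnth t i - ratr r| < k.+1%:R^-1.
  have [r] := @rat_in_itvoo R (tnth t i) (tnth t i + k.+1%:R^-1) ltac:(by rewrite ltrDl).
  rewrite in_itv/= => /andP[tr rt]; exists r.
  by rewrite distrC ger0_norm ?subr_ge0 ?(ltW tr)// ltrBlDl.
exists ([tuple c i | i < n], k); split=> [s sbox|i]; last by rewrite tnth_mktuple.
apply: eO; split=> // i j; rewrite (ord1 i) !mxE /ball/=.
have := sbox j; rewrite tnth_mktuple/= => sc.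
rewrite -(subrK (ratr (c j)) (tnth t j)) -addrA (le_lt_trans (ler_normD _ _))//.
rewrite (distrC (ratr _) (tnth s j)) [e]splitr.
by apply: ltrD; apply: lt_trans ke; [exact: cE|exact: sc].
Qed.

Lemma measurable_continuous_row_of_tuple (R : realType) (n : nat)
    (g : 'rV[R]_n -> R) :
  continuous g -> measurable_fun setT (g \o @row_of_tuple R n).
Proof.
move=> /continuousP cg; apply: (measurability _ (RGenOpens.measurableE R)).
move=> _ [_ [a [b ->]] <-]; rewrite setTI.
rewrite comp_preimage; apply: measurable_open_row_of_tuple.
by apply: cg; exact: interval_open.
Qed.

Lemma le_from_rat (R : realType) (f : R -> R) (x c : R) :
  {for x, continuous f} ->
  (\forall y \near x, forall r : rat, y = ratr r -> f y <= c) -> f x <= c.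
Proof.
move=> cf fc; rewrite leNgt; apply/negP => cfx.
have : \forall y \near x, c < f y /\ (forall r : rat, y = ratr r -> f y <= c).
  by apply: filterI => //; exact: (cvgr_gt _ cf).
move=> /nbhs_ballP[e /= e0 be].
have [r] := @rat_in_itvoo R x (x + e) ltac:(by rewrite ltrDl).
rewrite in_itv/= => /andP[xr re].
have [] := be (ratr r).
  by rewrite /ball/= distrC ger0_norm ?subr_ge0 ?(ltW xr)// ltrBlDl.
by move=> cr /(_ r erefl); rewrite leNgt cr.
Qed.

(** The Cauchy criterion for a limit at 0, with all quantifiers over countable types so that it
    yields a Borel set. The increment 0 is excluded, as for a difference quotient. *)
Definition rat_cauchy (R : realType) (q : R -> R) :=
  forall k : nat, exists m : nat, forall r s : rat,
    0 < `|ratr r : R| < m.+1%:R^-1 -> 0 < `|ratr s : R| < m.+1%:R^-1 ->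
    `|q (ratr r) - q (ratr s)| <= k.+1%:R^-1.

(** By continuity away from 0 and density of the rationals, the rational estimate extends to real
    increments, one argument at a time ([step1], then [step2]); completeness gives the limit. *)
Lemma is_cvg_rat_cauchyP (R : realType) (q : R -> R) :
  {in [pred h | h != 0], continuous q} ->
  cvg (q @ 0^') <-> rat_cauchy R q.
Proof.
move=> cq; split.
  move=> /cvg_ex[l ql] k.
  have k0 : 0 < k.+1%:R^-1 / 2 :> R by rewrite divr_gt0// invr_gt0.
  have [e /= e0 be] := (@cvgrPdist_le _ R^o _ _ _ _ _).1 ql _ k0.
  have [m _ /(_ m (leqnn m)) me] := near_infty_natSinv_lt (PosNum e0).
  exists m => r s /andP[r0 rm] /andP[s0 sm].
  have qr t : 0 < `|t| < m.+1%:R^-1 -> `|l - q t| <= k.+1%:R^-1 / 2.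
    move=> /andP[t0 tm]; apply: be; last by rewrite -normr_gt0.
    by rewrite /ball_/= sub0r normrN (lt_trans tm).
  rewrite -(subrK l (q (ratr r))) -addrA (le_trans (ler_normD _ _))//.
  rewrite [leRHS]splitr lerD// ?qr ?r0 ?s0//.
  by rewrite distrC qr// r0.
move=> rq; apply/cauchy_cvgP/cauchy_ballP => e e0.
have [k _ /(_ k (leqnn k)) ke] := near_infty_natSinv_lt (PosNum e0).
have [m qm] := rq k.
have near0 (x : R) : 0 < `|x| < m.+1%:R^-1 ->
    \forall y \near x, 0 < `|y| < m.+1%:R^-1.
  move=> /andP[x0 xm]; near=> y; apply/andP; split; near: y.
    by apply: (@cvgr_gt _ _ _ _ (fun y : R => `|y|) `|x|) => //; exact: norm_continuous.
  by apply: (@cvgr_lt _ _ _ _ (fun y : R => `|y|) `|x|) => //; exact: norm_continuous.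
have step1 r (y : R) : 0 < `|ratr r : R| < m.+1%:R^-1 -> 0 < `|y| < m.+1%:R^-1 ->
    `|q y - q (ratr r)| <= k.+1%:R^-1.
  move=> r0 y0; apply: (@le_from_rat _ (fun y => `|q y - q (ratr r)|)).
    apply: cvg_norm; apply: cvgB; last exact: cvg_cst.
    by apply: cq; rewrite inE -normr_gt0; case/andP: y0.
  near=> z => s zs; rewrite {1}zs; apply: qm => //.
  by rewrite -zs; near: z; exact: near0.
have step2 (x y : R) : 0 < `|x| < m.+1%:R^-1 -> 0 < `|y| < m.+1%:R^-1 ->
    `|q x - q y| <= k.+1%:R^-1.
  move=> x0 y0; apply: (@le_from_rat _ (fun y => `|q x - q y|)).
    apply: cvg_norm; apply: cvgB; first exact: cvg_cst.
    by apply: cq; rewrite inE -normr_gt0; case/andP: y0.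
  near=> z => s zs; rewrite zs; apply: step1 => //.
  by rewrite -zs; near: z; exact: near0.
near_simpl; near=> x y => /=; rewrite /ball/= (le_lt_trans _ ke)//; apply: step2.
  near: x.
  near=> z; rewrite normr_gt0; apply/andP; split; near: z.
    exact: nbhs_dnbhs_neq.
  exact: dnbhs0_lt.
near: y.
near=> z; rewrite normr_gt0; apply/andP; split; near: z.
  exact: nbhs_dnbhs_neq.
exact: dnbhs0_lt.
Unshelve. all: by end_near. Qed.

Lemma measurable_derivable_row_of_tuple (R : realType) (n : nat)
    (G : 'rV[R]_n -> R) (v : 'rV[R]_n) : continuous G ->
  measurable [set t : n.-tuple (measurableTypeR R) |
    derivable G (row_of_tuple t) v].
Proof.
move=> cG.
pose q (x : 'rV[R]_n) (h : R) : R := h^-1 * (G (h *: v + x) - G x).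
have cq x : {in [pred h | h != 0], continuous (q x)}.
  move=> h; rewrite inE => h0.
  apply: cvgM; first exact: (cvgV h0 cvg_id).
  apply: cvgB; last exact: cvg_cst.
  apply: continuous_comp; last exact: cG.
  by apply: cvgD; [apply: cvgZr_tmp; exact: cvg_id|exact: cvg_cst].
rewrite (_ : [set t | _] = [set t | rat_cauchy R (q (row_of_tuple t))]); last first.
  by apply/seteqP; split => t /= /(is_cvg_rat_cauchyP _ _ (cq _)).
apply: measurable_forall_countable => k; apply: measurable_exists_countable => m.
apply: measurable_forall_countable => r; apply: measurable_forall_countable => s.
do 2 apply: measurable_imply.
(* For fixed rational increments the difference of the two quotients is continuous in the base
   point, so each elementary condition is Borel. *)
pose g x : R := `|q x (ratr r) - q x (ratr s)|.
have cg : continuous g.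
  have cqh h : continuous (fun x => h^-1 * (G (h *: v + x) - G x)).
    move=> x.
    apply: (@continuousM _ _ (fun=> h^-1) (fun x => G (h *: v + x) - G x)).
      exact: cst_continuous.
    apply: continuousB; last exact: cG.
    apply: continuous_comp; last exact: cG.
    apply: (@continuousD _ _ _ (fun=> h *: v) id); [exact: cst_continuous|exact: cvg_id].
  move=> x; apply: (@continuous_comp _ _ _ (q ^~ (ratr r) - q ^~ (ratr s)) Num.norm).
    by apply: continuousB; exact: cqh.
  exact: norm_continuous.
have := measurable_continuous_row_of_tuple R n g cg measurableT
  `]-oo, k.+1%:R^-1]%classic (measurable_itv _).
by rewrite setTI.
Qed.

(** * Null sets from one-dimensional sections *)

Definition tuple_upd {T : Type} {n : nat} (t : n.-tuple T) (i : 'I_n) (x : T) :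
  n.-tuple T := [tuple if j == i then x else tnth t j | j < n].

Lemma cons_pair_upd (R : realType) (n : nat) (x y : measurableTypeR R)
    (t : n.-tuple (measurableTypeR R)) (j : 'I_n) :
  cons_pair (x, tuple_upd t j y) = tuple_upd (cons_pair (x, t)) (lift ord0 j) y.
Proof.
apply: eq_from_tnth => k; rewrite tnth_mktuple.
case: (unliftP ord0 k) => [i|] ->.
  by rewrite /cons_pair !tnthS tnth_mktuple (inj_eq lift_inj).
by rewrite /cons_pair !tnth0 (negbTE (neq_lift _ _)).
Qed.

Lemma cons_pair_upd0 (R : realType) (n : nat) (x y : measurableTypeR R)
    (t : n.-tuple (measurableTypeR R)) :
  cons_pair (y, t) = tuple_upd (cons_pair (x, t)) ord0 y.
Proof.
apply: eq_from_tnth => k; rewrite tnth_mktuple.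
case: (unliftP ord0 k) => [i|] ->; last by rewrite /cons_pair tnth0 eqxx.
by rewrite /cons_pair !tnthS eq_sym (negbTE (neq_lift _ _)).
Qed.

(** Induction along the recursive construction of [lebesgue_tuple]. For a later coordinate, the
    sections at fixed first coordinate are null by induction; for the first coordinate, Tonelli
    exchanges the order of integration. *)
Lemma lebesgue_tuple_null_sections (R : realType) (n : nat) (i : 'I_n)
    (N : set (n.-tuple (measurableTypeR R))) :
  measurable N ->
  (forall t, lebesgue_measure [set x | N (tuple_upd t i x)] = 0)%E ->
  lebesgue_tuple R n N = 0%E.
Proof.
elim: n i N => [[]//|n IHn] i N mN N0.
pose N' := @cons_pair R n @^-1` N.
have mN' : measurable N'.
  by rewrite -[X in measurable X]setTI; exact: measurable_cons_pair.
rewrite /= /lebesgue_cons /pushforward -/N'.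
case: (unliftP ord0 i) N0 => [j|] -> N0.
  rewrite /product_measure1 integral0_eq// => x _ /=.
  apply: (IHn j); first exact: measurable_xsection.
  move=> t; rewrite -[RHS](N0 (cons_pair (x, t))).
  congr (lebesgue_measure _); apply/seteqP.
  by split=> y /=; rewrite xsectionE /N' /= cons_pair_upd.
transitivity
    ((\int[lebesgue_tuple R n]_y ((@lebesgue_measure R) \o ysection N') y)%E).
  rewrite -indic_fubini_tonelli_GE// -indic_fubini_tonelli//.
  by rewrite indic_fubini_tonelli_FE.
rewrite integral0_eq// => t _ /=.
(* The entry 0 is arbitrary: the update overwrites it. *)
rewrite -[RHS](N0 (cons_pair (0, t))).
congr (lebesgue_measure _); apply/seteqP.
by split=> y /=; rewrite ysectionE /N' /= (cons_pair_upd0 _ _ 0).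
Qed.

Lemma ae_derivable_lipschitz (R : realType) (n : nat) (K : R)
    (G : 'rV[R]_n -> R) (i : 'I_n) :
  continuous G ->
  (forall x h, `|G (h *: delta_mx 0 i + x) - G x| <= K * `|h|) ->
  lebesgue_tuple R n
    (~` [set t | derivable G (row_of_tuple t) (delta_mx 0 i)]) = 0%E.
Proof.
move=> cG lipG; apply: (lebesgue_tuple_null_sections _ _ i).
  exact: (measurableC (measurable_derivable_row_of_tuple _ _ _ _ cG)).
move=> t.
have updE y h : row_of_tuple (tuple_upd t i (h + y)) =
    h *: delta_mx 0 i + row_of_tuple (tuple_upd t i y).
  apply/rowP => j; rewrite !mxE !tnth_mktuple eqxx/= eq_sym.
  by case: eqP => _; rewrite ?mulr1 ?mulr0 ?add0r.
pose g y := G (row_of_tuple (tuple_upd t i y)).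
have lipg x y : `|g x - g y| <= K * `|x - y|.
  by have := lipG (row_of_tuple (tuple_upd t i y)) (x - y); rewrite -updE subrK.
have [N [mN N0 gN]] := lipschitz_ae_derivable _ _ _ lipg.
apply: (subset_measure0 _ mN _ N0).
  have mupd : measurable_fun setT (tuple_upd t i).
    apply/measurable_fun_tnthP => j /=.
    rewrite (_ : _ \o _ = fun y => if j == i then y else tnth t j); last first.
      by apply/funext => y /=; rewrite tnth_mktuple.
    by case: (j == i); [exact: measurable_id|exact: measurable_cst].
  rewrite -[X in measurable X]setTI; apply: mupd => //.
  exact: (measurableC (measurable_derivable_row_of_tuple _ _ _ _ cG)).
apply: subset_trans gN => y /= ndG dg; apply: ndG.
(* Derivability of [g] at y and of [G] along the axis is convergence of the same difference
   quotient, once [h *: 1] is read as [h]. *)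
apply: (eq_ind _ (fun F : R -> R => cvg (F h @[h --> 0^'])) dg).
apply/funext => h; rewrite /shift /= /g -updE.
congr (_ *: (G (row_of_tuple (tuple_upd t i (_ + _))) - _)).
exact: mulr1.
Qed.

(** * Derivatives of the Lyapunov function *)

(** The difference quotient is exactly [a + h * b]. This serves every polynomial derivative below:
    the coefficient of [h] in the increment is the derivative. *)
Lemma is_derive_quadratic {R : realType} {V : normedModType R} (f : V -> R)
    (x v : V) (a b : R) :
  (forall h : R, f (h *: v + x) - f x = h * a + h ^+ 2 * b) ->
  is_derive x v f a.
Proof.
move=> fE.
have fa : (fun h : R => h^-1 *: (f (h *: v + x) - f x)) @ 0^' --> a.
  have lina : (fun h : R => a + h * b) @ 0^' --> a.
    rewrite -[X in _ --> X]addr0 -[X in _ + X](mul0r b).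
    apply: cvgD; first exact: cvg_cst.
    apply: cvgM; last exact: cvg_cst.
    exact: cvg_within.
  apply: cvg_trans lina; apply: near_eq_cvg; near=> h.
  have h0 : h != 0 by near: h; exact: nbhs_dnbhs_neq.
  by rewrite fE /GRing.scale /=; field.
apply: DeriveDef; last exact: cvg_lim fa.
by apply/cvg_ex; exists a.
Unshelve. all: by end_near. Qed.

Lemma derive_le_lipschitz {R : realType} {V : normedModType R} (f : V -> R)
    (x v : V) (K : R) : derivable f x v ->
  (forall h : R, `|f (h *: v + x) - f x| <= K * `|h|) -> 'D_v f x <= K.
Proof.
move=> df lipf; apply: limr_le; first exact: df.
near=> h; have h0 : h != 0 by near: h; exact: nbhs_dnbhs_neq.
rewrite (le_trans (ler_norm _))// normrM normfV mulrC ler_pdivrMr ?normr_gt0//.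
exact: lipf.
Unshelve. all: by end_near. Qed.

(** * Euclidean inner product and norm *)

Section Euclid.
Context {R : realType} {n : nat}.
Implicit Types x y z : 'rV[R]_n.

Lemma dotpC x y : dotp x y = dotp y x.
Proof. by apply: eq_bigr => i _; rewrite mulrC. Qed.

Lemma dotpDl x y z : dotp (x + y) z = dotp x z + dotp y z.
Proof. by rewrite -big_split; apply: eq_bigr => i _; rewrite mxE mulrDl. Qed.

Lemma dotpZl a x y : dotp (a *: x) y = a * dotp x y.
Proof. by rewrite mulr_sumr; apply: eq_bigr => i _; rewrite mxE mulrA. Qed.

Lemma dotpDr x y z : dotp x (y + z) = dotp x y + dotp x z.
Proof. by rewrite dotpC dotpDl !(dotpC x). Qed.

Lemma dotpZr a x y : dotp x (a *: y) = a * dotp x y.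
Proof. by rewrite dotpC dotpZl dotpC. Qed.

Lemma dotpNl x y : dotp (- x) y = - dotp x y.
Proof. by rewrite -scaleN1r dotpZl mulN1r. Qed.

Lemma dotp_ge0 x : 0 <= dotp x x.
Proof. by apply: sumr_ge0 => i _; rewrite -expr2 sqr_ge0. Qed.

Lemma enorm_sqr x : enorm x ^+ 2 = dotp x x.
Proof.
rewrite /enorm sqr_sqrtr; first by apply: eq_bigr => i _; rewrite expr2.
by apply: sumr_ge0 => i _; rewrite sqr_ge0.
Qed.

Lemma coord_le_enorm x i : `|x 0 i| <= enorm x.
Proof.
rewrite -sqrtr_sqr ler_wsqrtr// (bigD1 i)//= lerDl.
by apply: sumr_ge0 => j _; rewrite sqr_ge0.
Qed.

Lemma dotp_delta x i : dotp x (delta_mx 0 i) = x 0 i.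
Proof.
rewrite /dotp (bigD1 i)//= mxE !eqxx mulr1 big1 ?addr0// => j ji.
by rewrite mxE (negbTE ji) andbF mulr0.
Qed.

Lemma enorm_delta (h : R) i : enorm (h *: delta_mx 0 i : 'rV[R]_n) = `|h|.
Proof.
rewrite -[LHS]ger0_norm ?sqrtr_ge0// -sqrtr_sqr enorm_sqr dotpZr dotp_delta.
by rewrite !mxE !eqxx mulr1 -expr2 sqrtr_sqr.
Qed.

End Euclid.

(** * The smallest eigenvalue *)

Section MuMin.
Context {R : realType} (gamma lambda : R).

Let S := Num.sqrt ((gamma ^+ 2 * (1 - lambda) - 2) ^+ 2 + 4 * gamma ^+ 2).

Let sqrS : S ^+ 2 = (gamma ^+ 2 * (1 - lambda) - 2) ^+ 2 + 4 * gamma ^+ 2.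
Proof. by rewrite sqr_sqrtr// addr_ge0 ?sqr_ge0// mulr_ge0 ?sqr_ge0. Qed.

(** With T = gamma^2 (1 - lambda), compare the squares of T + 2 and of the root [S]: their
    difference is 4 gamma^2 (1 - 2 lambda), positive because lambda < 1/2. *)
Lemma mu_min_gt0 : 0 < gamma -> lambda <= 4^-1 -> 0 < mu_min gamma lambda.
Proof.
move=> gamma_gt0 lambda_le; have g2 : 0 < gamma ^+ 2 by exact: exprn_gt0.
rewrite /mu_min -/S mulr_gt0 ?invr_gt0// subr_gt0.
have gl : 0 <= gamma ^+ 2 * (1 - lambda) by rewrite mulr_ge0 ?ltW//; lra.
rewrite -ltr_sqr ?nnegrE ?sqrtr_ge0//; last by lra.
by rewrite sqrS; nra.
Qed.

Lemma c1_gt0 : 0 < gamma -> lambda <= 4^-1 -> 0 < c1 gamma lambda.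
Proof. by move=> ? ?; rewrite lt_min ltr01 mu_min_gt0. Qed.

Lemma mu_min_lt_half : 0 < gamma -> mu_min gamma lambda < 2^-1.
Proof.
move=> gamma_gt0.
have SE : gamma ^+ 2 * (1 - lambda) - 2 < S.
  rewrite (le_lt_trans (ler_norm _))// -ltr_sqr ?nnegrE ?sqrtr_ge0//.
  by rewrite sqrS real_normK ?num_real// ltrDl mulr_gt0// exprn_gt0.
by rewrite /mu_min -/S; lra.
Qed.

(** This is the characteristic equation of the matrix of the quadratic part of [V0], evaluated at
    its root [mu_min]. *)
Lemma mu_min_det :
  (gamma ^+ 2 * (1 - lambda) / 4 - mu_min gamma lambda) *
  (2^-1 - mu_min gamma lambda) = (gamma / 4) ^+ 2.
Proof.
transitivity ((S ^+ 2 - (gamma ^+ 2 * (1 - lambda) - 2) ^+ 2) / 64).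
  by rewrite /mu_min -/S; field.
by rewrite sqrS; field.
Qed.

End MuMin.

Section Potential.
Context {R : realType} {d : nat} (gamma lambda : R) (U : 'rV[R]_d -> R).
Hypothesis gamma_gt0 : 0 < gamma.

Local Notation V := (V0 gamma lambda U).

Lemma V0E q p : V q p = U q + gamma ^+ 2 / 4 * (1 - lambda) * dotp q q
  + gamma / 2 * dotp q p + dotp p p / 2.
Proof.
rewrite /V0 !enorm_sqr dotpDl !dotpDr !dotpZl !dotpZr (dotpC p q).
by field; rewrite gt_eqF.
Qed.

(** Subtracting mu times the identity makes the quadratic form degenerate: by [mu_min_det], its
    product with [2^-1 - mu > 0] is exactly the square of the norm of
    [(gamma / 4) *: q + (2^-1 - mu) *: p]. *)
Lemma V0_ge q p :
  U q + mu_min gamma lambda * (dotp q q + dotp p p) <= V q p.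
Proof.
have mu2 := mu_min_lt_half _ lambda gamma_gt0.
have detE := mu_min_det gamma lambda.
set mu := mu_min gamma lambda in mu2 detE *.
have := dotp_ge0 ((gamma / 4) *: q + (2^-1 - mu) *: p).
rewrite dotpDl !dotpDr !dotpZl !dotpZr (dotpC p q).
have -> : gamma / 4 * (gamma / 4 * dotp q q) +
    gamma / 4 * ((2^-1 - mu) * dotp q p) +
   ((2^-1 - mu) * (gamma / 4 * dotp q p) +
    (2^-1 - mu) * ((2^-1 - mu) * dotp p p)) =
   (2^-1 - mu) * ((gamma ^+ 2 * (1 - lambda) / 4 - mu) * dotp q q
     + gamma / 2 * dotp q p + (2^-1 - mu) * dotp p p).
  have -> : gamma / 4 * (gamma / 4 * dotp q q) = (gamma / 4) ^+ 2 * dotp q q by ring.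
  by rewrite -detE; field.
rewrite pmulr_rge0 ?subr_gt0// V0E => H.
rewrite -subr_ge0; apply: le_trans H _.
by rewrite le_eqVlt; apply/orP; left; apply/eqP; field.
Qed.

Lemma is_derive_V0q q p i : derivable U q (delta_mx 0 i) ->
  is_derive q (delta_mx 0 i) (V^~ p)
    (partial i U q + (gamma ^+ 2 / 2 * (1 - lambda) * q 0 i + gamma / 2 * p 0 i)).
Proof.
(* [W] is the purely quadratic part of [V0], whose increments are computed exactly. *)
move=> dU; pose W x := V x p - U x.
have -> : V^~ p = U + W by apply/funext => x; rewrite /W /GRing.add /= addrCA subrr addr0.
apply: is_deriveD; first exact: derivableP.
apply: (@is_derive_quadratic _ _ _ _ _ _ (gamma ^+ 2 / 4 * (1 - lambda))) => h.
rewrite /W !V0E !dotpDl !dotpDr !dotpZl !dotpZr.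
rewrite !(dotpC (delta_mx 0 i)) !dotp_delta !mxE !eqxx /=.
by field.
Qed.

Lemma is_derive_V0p q p i :
  is_derive p (delta_mx 0 i) (V q) (gamma / 2 * q 0 i + p 0 i).
Proof.
apply: (@is_derive_quadratic _ _ _ _ _ _ (2^-1)) => h.
rewrite !V0E !dotpDl !dotpDr !dotpZl !dotpZr.
rewrite !(dotpC (delta_mx 0 i)) !dotp_delta !mxE !eqxx /=.
by field.
Qed.

Hypothesis dU : forall q, differentiable U q.

Lemma partial_V0q p i : partial i (V^~ p) = fun q =>
  partial i U q + (gamma ^+ 2 / 2 * (1 - lambda) * q 0 i + gamma / 2 * p 0 i).
Proof.
apply/funext => q.
by rewrite [LHS]/partial; have [_ ->] := is_derive_V0q q p i (diff_derivable (dU q)).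
Qed.

Lemma partial_V0p q i : partial i (V q) = fun p => gamma / 2 * q 0 i + p 0 i.
Proof.
apply/funext => p.
by rewrite [LHS]/partial; have [_ ->] := is_derive_V0p q p i.
Qed.

Lemma is_derive2_V0q q p i : derivable (partial i U) q (delta_mx 0 i) ->
  is_derive q (delta_mx 0 i) (partial i (V^~ p))
    (partial i (partial i U) q + gamma ^+ 2 / 2 * (1 - lambda)).
Proof.
move=> d2U; rewrite partial_V0q.
apply: (@is_deriveD _ _ _ (partial i U)); first exact: derivableP.
apply: (@is_derive_quadratic _ _ _ _ _ _ 0) => h.
by rewrite !mxE !eqxx /=; field.
Qed.

Lemma is_derive2_V0p q p i :
  is_derive p (delta_mx 0 i) (partial i (V q)) 1.
Proof.
rewrite partial_V0p; apply: (@is_derive_quadratic _ _ _ _ _ _ 0) => h.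
by rewrite !mxE !eqxx /=; field.
Qed.

Lemma grad_V0q q p : grad (V^~ p) q =
  grad U q + (gamma ^+ 2 / 2 * (1 - lambda)) *: q + (gamma / 2) *: p.
Proof. by apply/rowP => i; rewrite !mxE partial_V0q addrA. Qed.

Lemma grad_V0p q p : grad (V q) p = (gamma / 2) *: q + p.
Proof. by apply/rowP => i; rewrite !mxE partial_V0p. Qed.

Lemma laplacian_V0p q p : laplacian (V q) p = d%:R.
Proof.
rewrite /laplacian (eq_bigr (fun=> 1)); first by rewrite sumr_const card_ord.
by move=> i _; have [_] := is_derive2_V0p q p i.
Qed.

Lemma laplacian_V0q q p :
  (forall i, derivable (partial i U) q (delta_mx 0 i)) ->
  laplacian (V^~ p) q = laplacian U q + gamma ^+ 2 / 2 * d%:R * (1 - lambda).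
Proof.
move=> d2U; rewrite /laplacian.
rewrite (eq_bigr (fun i => partial i (partial i U) q + gamma ^+ 2 / 2 * (1 - lambda))).
  rewrite big_split sumr_const card_ord -mulr_natr.
  by congr (_ + _); ring.
by move=> i _; have [_] := is_derive2_V0q q p i (d2U i).
Qed.

Lemma generator_defined_V0 q p :
  (forall i, derivable (partial i U) q (delta_mx 0 i)) ->
  generator_defined V q p.
Proof.
move=> d2U i; split.
- by case: (is_derive_V0q q p i (diff_derivable (dU q))).
- by case: (is_derive_V0p q p i).
- by case: (is_derive2_V0q q p i (d2U i)).
- by case: (is_derive2_V0p q p i).
Qed.

End Potential.

(** The exceptional set is a cylinder over a null set; it stays null even over a factor of infinite
    measure, since 0 times infinity is 0. *)
Lemma ae_phase_space_fst (R : realType) (d : nat) (P : 'rV[R]_d -> Prop) :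
  measurable [set t | P (row_of_tuple t)] ->
  lebesgue_tuple R d (~` [set t | P (row_of_tuple t)]) = 0%E ->
  ae_phase_space (fun q _ => P q).
Proof.
move=> mP P0; exists ((~` [set t | P (row_of_tuple t)]) `*` setT); split.
- by apply: measurableX => //; exact: measurableC.
- rewrite product_measure1E//=; first by rewrite P0 mul0e.
  exact: measurableC.
- by move=> [t s] /= nP; split.
Qed.

(** * Drift inequality *)

Lemma generator_V0E (R : realType) (d : nat) (gamma lambda alpha : R)
    (U : 'rV[R]_d -> R) (q p : 'rV[R]_d) : 0 < gamma ->
  (forall q, differentiable U q) ->
  let g := grad U q in
  let w := (gamma ^+ 2 / 2 * (1 - lambda)) *: q + (gamma / 2) *: p in
  generator gamma U alpha (V0 gamma lambda U) q p =
    dotp p (g + w) - dotp (gamma *: p + g) ((gamma / 2) *: q + p) + gamma * d%:R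
    + alpha * (laplacian ((V0 gamma lambda U)^~ p) q - dotp g (g + w)).
Proof.
move=> gamma_gt0 dU g w; rewrite /generator grad_V0q// grad_V0p// laplacian_V0p//.
rewrite -/g -(addrA g) -/w dotpDl dotpNl dotpZl scaleNr -opprD dotpNl.
by ring.
Qed.

(** The terms in p.g cancel and those in q.p agree on both sides. What remains is gamma times the
    slack in the drift condition plus the two nonnegative squares collected in [H]. *)
Lemma hamiltonian_part_le (R : realType) (d : nat) (gamma lambda A u : R)
    (g q p : 'rV[R]_d) :
  0 < gamma -> lambda <= 4^-1 ->
  lambda * (u + gamma ^+ 2 / 4 * dotp q q) - A <= 2^-1 * dotp q g ->
  dotp p (g + ((gamma ^+ 2 / 2 * (1 - lambda)) *: q + (gamma / 2) *: p))
    - dotp (gamma *: p + g) ((gamma / 2) *: q + p) <=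
    gamma * (A - lambda * (u + gamma ^+ 2 / 4 * (1 - lambda) * dotp q q
               + gamma / 2 * dotp q p + dotp p p / 2)).
Proof.
move=> gamma_gt0 lambda_le drift.
rewrite !dotpDl !dotpDr !dotpZl !dotpZr (dotpC g q) (dotpC g p) (dotpC p q).
have qq := dotp_ge0 q; have pp := dotp_ge0 p.
move: (dotp q q) (dotp p p) (dotp q p) (dotp q g) (dotp p g) drift qq pp.
move=> qq pp qp qg pg drift qq0 pp0.
have H : 0 <= (1 - lambda) * pp / 2 + lambda ^+ 2 * (gamma ^+ 2 / 4) * qq.
  apply: addr_ge0; first by rewrite divr_ge0// mulr_ge0//; lra.
  by rewrite mulr_ge0// mulr_ge0 ?divr_ge0 ?sqr_ge0.
rewrite -subr_ge0.
rewrite (_ : _ - _ = gamma * ((2^-1 * qg - (lambda * (u + gamma ^+ 2 / 4 * qq) - A))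
   + ((1 - lambda) * pp / 2 + lambda ^+ 2 * (gamma ^+ 2 / 4) * qq))); last by field.
by rewrite mulr_ge0 ?(ltW gamma_gt0)// addr_ge0// subr_ge0.
Qed.

Lemma completed_square_le (R : realType) (d : nat) (a b : R) (g q p : 'rV[R]_d) :
  - dotp g (g + (a *: q + b *: p)) <=
    (a ^+ 2 + b ^+ 2) * (dotp q q + dotp p p).
Proof.
have := dotp_ge0 (g + 2^-1 *: (a *: q + b *: p)).
(* This square controls the cross term: |a q + b p|^2 is at most 2 a^2 |q|^2 + 2 b^2 |p|^2. *)
have := dotp_ge0 (a *: q + (- b) *: p).
rewrite !dotpDl !dotpDr !dotpZl !dotpZr !dotpDr !dotpZr !dotpDl !dotpZl.
rewrite !(dotpC q g) !(dotpC p g) (dotpC p q).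
have := dotp_ge0 q; have := dotp_ge0 p.
move: (dotp q q) (dotp p p) (dotp q p) (dotp g q) (dotp g p) (dotp g g).
move=> qq pp qp gq gp gg pp0 qq0 H1 H2.
have b2 : 0 <= b ^+ 2 * qq by rewrite mulr_ge0 ?sqr_ge0.
have a2 : 0 <= a ^+ 2 * pp by rewrite mulr_ge0 ?sqr_ge0.
have b3 : 0 <= b ^+ 2 * pp by rewrite mulr_ge0 ?sqr_ge0.
have a3 : 0 <= a ^+ 2 * qq by rewrite mulr_ge0 ?sqr_ge0.
by nra.
Qed.

Lemma partial_lipschitz (R : realType) (d : nat) (L : R) (U : 'rV[R]_d -> R)
    (i : 'I_d) :
  (forall q q', enorm (grad U q - grad U q') <= L * enorm (q - q')) ->
  forall (x : 'rV[R]_d) (h : R),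
    `|partial i U (h *: delta_mx 0 i + x) - partial i U x| <= L * `|h|.
Proof.
move=> lip x h; rewrite -(enorm_delta h i) -[X in enorm X](addrK x).
apply: le_trans (lip _ _); apply: le_trans (coord_le_enorm _ i).
by rewrite !mxE.
Qed.

(** * The terms carrying alpha *)

Section Overdamped.
Context {R : realType} {d : nat} (gamma L lambda : R) (U : 'rV[R]_d -> R).

Lemma K_A_factor_gt0 : 0 < gamma ->
  0 < gamma ^+ 4 / 4 * (1 - lambda) ^+ 2 + gamma ^+ 2 / 4.
Proof.
move=> g0; have gt0 n : 0 < gamma ^+ n / 4 by rewrite divr_gt0// exprn_gt0.
by rewrite ltr_wpDl// mulr_ge0 ?sqr_ge0// ltW.
Qed.

Lemma K_A_gt0 : 0 < gamma -> lambda <= 4^-1 -> 0 < K_A gamma lambda.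
Proof. by move=> g0 l4; rewrite mulr_gt0 ?invr_gt0 ?c1_gt0 ?K_A_factor_gt0. Qed.

Lemma K_Delta_ge0 : 0 < L -> lambda <= 4^-1 -> 0 <= K_Delta d gamma L lambda.
Proof.
move=> L0 l4; apply: addr_ge0; first by rewrite mulr_ge0// ltW.
apply: mulr_ge0; [by rewrite mulr_ge0// divr_ge0// sqr_ge0|lra].
Qed.

(** The squared coefficients of w add up to the bracket in [K_A], and [c1 <= mu_min] turns the
    hypothesis into [c1 * s <= V]. *)
Lemma K_A_bound (V s : R) : 0 < gamma -> lambda <= 4^-1 -> 0 <= s ->
  mu_min gamma lambda * s <= V ->
  ((gamma ^+ 2 / 2 * (1 - lambda)) ^+ 2 + (gamma / 2) ^+ 2) * s <=
    K_A gamma lambda * V.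
Proof.
move=> g0 l4 s0 sV; have c0 := c1_gt0 _ _ g0 l4.
have -> : (gamma ^+ 2 / 2 * (1 - lambda)) ^+ 2 + (gamma / 2) ^+ 2 =
    gamma ^+ 4 / 4 * (1 - lambda) ^+ 2 + gamma ^+ 2 / 4 by field.
rewrite /K_A -[leRHS]mulrA [leRHS]mulrCA ler_wpM2l//.
  exact/ltW/K_A_factor_gt0.
rewrite ler_pdivlMl// (le_trans _ sV)// ler_wpM2r//.
by rewrite ge_min lexx orbT.
Qed.

Lemma laplacian_le :
  (forall q q', enorm (grad U q - grad U q') <= L * enorm (q - q')) ->
  forall q, (forall i, derivable (partial i U) q (delta_mx 0 i)) ->
  laplacian U q <= L * d%:R.
Proof.
move=> lip q d2U.
rewrite mulr_natr -[d in leRHS]card_ord -sumr_const; apply: ler_sum => i _.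
by apply: derive_le_lipschitz => // h; exact: partial_lipschitz.
Qed.

(** The square is absorbed by [K_A * V] and the Laplacian by [K_Delta]. As V is nonnegative, the
    missing [K_A + K_Delta * V] can be added, so that one constant [J1] serves both [A_alpha] and
    [lambda_hat]. *)
Lemma overdamped_part_le (q p : 'rV[R]_d) :
  0 < gamma -> 0 < L -> lambda <= 4^-1 ->
  (forall q, differentiable U q) -> (forall q, 0 <= U q) ->
  (forall q q', enorm (grad U q - grad U q') <= L * enorm (q - q')) ->
  (forall i, derivable (partial i U) q (delta_mx 0 i)) ->
  laplacian ((V0 gamma lambda U)^~ p) q
    - dotp (grad U q) (grad U q + ((gamma ^+ 2 / 2 * (1 - lambda)) *: q
                                    + (gamma / 2) *: p))
  <= J1 d gamma L lambda * (1 + V0 gamma lambda U q p).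
Proof.
move=> g0 L0 l4 dU U0 lip d2U; rewrite laplacian_V0q//.
have VU := V0_ge gamma lambda U g0 q p.
set s := dotp q q + dotp p p in VU.
have s0 : 0 <= s by rewrite addr_ge0 ?dotp_ge0.
have sV : mu_min gamma lambda * s <= V0 gamma lambda U q p.
  by apply: le_trans VU; rewrite lerDr.
have V_ge0 : 0 <= V0 gamma lambda U q p.
  by apply: le_trans sV; rewrite mulr_ge0// ltW// mu_min_gt0.
have KA := ltW (K_A_gt0 g0 l4); have KD := K_Delta_ge0 L0 l4.
have H1 := K_A_bound _ _ g0 l4 s0 sV.
have H2 := completed_square_le _ _ (gamma ^+ 2 / 2 * (1 - lambda)) (gamma / 2)
  (grad U q) q p.
have H3 := laplacian_le lip q d2U.
have H4 : 0 <= K_Delta d gamma L lambda * V0 gamma lambda U q p by rewrite mulr_ge0.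
have H5 : laplacian U q + gamma ^+ 2 / 2 * d%:R * (1 - lambda)
    <= K_Delta d gamma L lambda.
  by rewrite /K_Delta lerD2r.
rewrite /J1 mulrDr mulr1 mulrDl.
have H6 := le_trans H2 H1.
move: (dotp _ _) (V0 _ _ _ _ _) (laplacian _ _) (K_A _ _) (K_Delta _ _ _ _) KA KD H4 H5 H6.
by clear; intros; lra.
Qed.

End Overdamped.

Theorem proposition2p2 (R : realType) (d : nat) (hd : (1 <= d)%N)
    (gamma L A lambda : R) (U : 'rV[R]_d -> R)
    (gamma_gt0 : 0 < gamma) (L_gt0 : 0 < L) (A_gt0 : 0 < A)
    (lambda_gt0 : 0 < lambda) (lambda_le : lambda <= 4^-1)
    (U_C1 : C1 U) (U_ge0 : forall q, 0 <= U q)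
    (gradU_lip : forall q q',
       enorm (grad U q - grad U q') <= L * enorm (q - q'))
    (U_drift : forall q, 2^-1 * dotp q (grad U q) >=
       lambda * (U q + gamma ^+ 2 / 4 * enorm q ^+ 2) - A) :
  [/\ forall alpha : R, 0 <= alpha ->
        ae_phase_space (fun q p =>
          generator_defined (V0 gamma lambda U) q p /\
          generator gamma U alpha (V0 gamma lambda U) q p <=
            gamma * (d%:R + A_alpha d gamma L A lambda alpha
                     - lambda_hat d gamma L lambda alpha
                       * V0 gamma lambda U q p)),
      forall q p : 'rV[R]_d,
        generator gamma U 0 (V0 gamma lambda U) q p <=
          gamma * (d%:R + A_alpha d gamma L A lambda 0
                   - lambda_hat d gamma L lambda 0 * V0 gamma lambda U q p),
      forall alpha : R, 0 <= alpha ->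
        lambda_hat d gamma L lambda alpha =
          lambda - alpha / gamma *
            ((c1 gamma lambda)^-1 *
               (gamma ^+ 4 / 4 * (1 - lambda) ^+ 2 + gamma ^+ 2 / 4)
             + L * d%:R + gamma ^+ 2 / 2 * d%:R * (1 - lambda)) &
      forall alpha : R, 0 <= alpha <= alpha0 d gamma L lambda ->
        lambda_hat d gamma L lambda alpha >= lambda / 2 /\ lambda / 2 > 0].
Proof.
have [dU cgradU] := U_C1.
(* The bound on the alpha part is assumed with its factor [alpha], so that at alpha = 0 it holds at
   every point, even where second derivatives of U fail to exist. *)
have le_drift alpha q p :
    alpha * (laplacian ((V0 gamma lambda U)^~ p) q
      - dotp (grad U q) (grad U q + ((gamma ^+ 2 / 2 * (1 - lambda)) *: q
                                    + (gamma / 2) *: p)))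
      <= alpha * (J1 d gamma L lambda * (1 + V0 gamma lambda U q p)) ->
    generator gamma U alpha (V0 gamma lambda U) q p <=
      gamma * (d%:R + A_alpha d gamma L A lambda alpha
               - lambda_hat d gamma L lambda alpha * V0 gamma lambda U q p).
  move=> le_alpha; rewrite generator_V0E//.
  have drift := U_drift q; rewrite enorm_sqr in drift.
  have := hamiltonian_part_le _ _ _ _ _ _ (grad U q) q p
    gamma_gt0 lambda_le drift.
  rewrite -V0E// => le_ham.
  apply: le_trans (lerD (lerD le_ham (lexx _)) le_alpha) _.
  (* Equality holds: [alpha * J1] goes into [A_alpha], and [alpha * J1 * V] into [lambda_hat]. *)
  rewrite le_eqVlt; apply/orP; left; apply/eqP.
  by rewrite /A_alpha /lambda_hat; field; rewrite gt_eqF.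
split.
- move=> alpha a0.
  have cpU i : continuous (partial i U).
    rewrite (_ : partial i U = (fun M : 'rV[R]_d => M 0 i) \o grad U).
      move=> x; apply: continuous_comp; first exact: cgradU.
      exact: coord_continuous.
    by apply/funext => x; rewrite /= mxE.
  have ae_d2U i : ae_phase_space
      (fun q _ : 'rV[R]_d => derivable (partial i U) q (delta_mx 0 i)).
    apply: ae_phase_space_fst; first exact: measurable_derivable_row_of_tuple.
    by apply: ae_derivable_lipschitz => // x h; exact: partial_lipschitz.
  have := filter_forall (ae_filter_ringOfSetsType _) ae_d2U.
  apply: (filterS (Filter := ae_filter_ringOfSetsType _)) => -[t s] /= d2U.
  split; first exact: generator_defined_V0.
  by apply: le_drift; rewrite ler_wpM2l//; exact: overdamped_part_le.
- by move=> q p; apply: le_drift; rewrite ?mul0r.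
- by move=> alpha _; rewrite /lambda_hat /J1 /K_A /K_Delta; ring.
- move=> alpha /andP[a0 aa0]; split; last by rewrite divr_gt0.
  pose J := J1 d gamma L lambda.
  have J_gt0 : 0 < J.
    by rewrite ltr_wpDr ?K_A_gt0// K_Delta_ge0.
  (* Up to reassociation, [alpha0] is [gamma * lambda / 2] divided by [J]. *)
  have : alpha * J <= gamma * lambda / 2.
    move: aa0; rewrite /alpha0 -addrA -/(K_A gamma lambda).
    by rewrite -/(J1 d gamma L lambda) -/J ler_pdivlMr.
  rewrite /lambda_hat -/J => aJ.
  have : J / gamma * alpha <= lambda / 2.
    by rewrite mulrAC ler_pdivrMr// mulrC; lra.
  by lra.
Qed.
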